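(* For every positive integer $k$, there exist infinitely many positive integers $n$ with fixed point order $k$.
   Context: The Fibonacci sequence is defined by $F_0=0$, $F_1=1$, $F_n=F_{n-1}+F_{n-2}$ for $n\ge 2$. For a positive integer $n$, the order of appearance $z(n)$ is the smallest positive integer $\ell$ such that $n\mid F_\ell$ (it exists for every $n \geq 1$). For $k\ge 1$, $z^k(n)$ denotes the $k$-th iterate of $z$ applied to $n$ (so $z^1(n)=z(n)$ and $z^{k+1}(n)=z(z^k(n))$). A fixed point is a positive integer $n$ with $z(n)=n$. The fixed point order of a positive integer $n$ is $0$ if $n$ is a fixed point; otherwise it is the smallest positive integer $k$ such that $z^k(n)$ is a fixed point, if such a $k$ exists. *)

(* Defs.v *)
From mathcomp Require Import all_boot all_algebra.
From mathcomp Require Import boolp classical_sets functions cardinality.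

Set Implicit Arguments.
Unset Strict Implicit.
Unset Printing Implicit Defensive.

Fixpoint fib (n : nat) : nat :=
  match n with
  | 0 => 0
  | m.+1 => match m with
            | 0 => 1
            | p.+1 => fib m + fib p
            end
  end.

Lemma fibSS n : fib n.+2 = fib n.+1 + fib n.
Proof. by []. Qed.

(* The shift (a, b) |-> (b, b + a) is a bijection of (Z/n)^2, so the Fibonacci
   sequence modulo n returns to (0, 1). *)
Lemma dvdn_fib_ex (n : nat) :
  0 < n -> exists l, (0 < l) && (n %| fib l).
Proof.
case: n => // m _.
pose f (x : 'I_m.+1 * 'I_m.+1) := (x.2, (x.2 + x.1)%R).
have f_inj : injective f.
  move=> [a b] [c d] fE; have /= ebd := congr1 fst fE.
  by have := congr1 snd fE; rewrite /= ebd => /GRing.addrI ->.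
pose x0 : 'I_m.+1 * 'I_m.+1 := (inZp 0, inZp 1).
have fE k : iter k f x0 = (inZp (fib k), inZp (fib k.+1)).
  elim: k => // k IHk; rewrite iterS IHk fibSS /f /=.
  by congr pair; apply: val_inj; rewrite /= modnDm.
exists (order f x0); rewrite order_gt0 /=.
have := iter_order f_inj x0; rewrite fE => /(congr1 (fun x => val x.1)) /=.
by rewrite mod0n => /eqP.
Qed.

Lemma order_of_appearance_ex (n : nat) :
  exists l, (0 < n) ==> (0 < l) && (n %| fib l).
Proof. by case: n => [|n]; [exists 0 | apply: dvdn_fib_ex]. Qed.

(* The value at n = 0, where no positive index qualifies, is 0. *)
Definition order_of_appearance (n : nat) : nat :=
  ex_minn (order_of_appearance_ex n).

Definition fixed_point (n : nat) : bool :=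
  (0 < n) && (order_of_appearance n == n).

(* A relation, since no such k is presupposed to exist for a given n. *)
Definition has_fixed_point_order (n k : nat) : Prop :=
  if fixed_point n then k = 0
  else [/\ 0 < k,
           fixed_point (iter k order_of_appearance n)
         & forall j, 0 < j -> fixed_point (iter j order_of_appearance n) ->
             k <= j].

(* Main.v *)
Require Import Defs.
From mathcomp Require Import all_boot all_algebra.
From mathcomp Require Import boolp classical_sets functions cardinality.
From mathcomp Require Import zify ring.

(* The order of appearance z satisfies v_3(F_n) = v_3(n) + 1 when 4 | n and
   v_5(F_n) = v_5(n); together with 4 | F_n <-> 6 | n this gives
   z(12 3^(j+1) 5^a) = 12 3^j 5^a, and 12 5^a is a fixed point.  Hence
   12 3^k 5^a has fixed point order k for every a.  For p = 3, 5 the valuation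
   grows by exactly one from F_m to F_{pm} once p | F_m: modulo p, the cofactor
   F_{pm} / (p F_m) is a power of F_{m-1}, which is coprime to F_m. *)

Lemma fibD m n : fib (m.+1 + n) = fib m.+1 * fib n.+1 + fib m * fib n.
Proof.
elim: m n => [|m IHm] n; first by rewrite mul1n mul0n addn0.
by rewrite addSnnS IHm !fibSS; ring.
Qed.

Lemma coprime_fibS n : coprime (fib n) (fib n.+1).
Proof. by elim: n => // n IHn; rewrite fibSS /coprime gcdnDl gcdnC. Qed.

(** By [fibD], raising the index by [q] multiplies the value modulo [d] by the Fibonacci number just
    before [fib q], which is coprime to [fib q] and hence to [d]. *)
Lemma dvdn_fib_modn d q n : 0 < q -> d %| fib q ->
  (d %| fib n) = (d %| fib (n %% q)).
Proof.
case: q => // q _ dq; rewrite [in LHS](divn_eq n q.+1).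
elim: (n %/ q.+1) => [|c IHc]; first by rewrite mul0n.
rewrite mulSn -addnA fibD -{}IHc (dvdn_addr _ (dvdn_mulr _ dq)) Gauss_dvdr //.
by apply: coprime_dvdl dq _; rewrite coprime_sym coprime_fibS.
Qed.

(** Reduces each concrete instance to a computation over one block of [q] indices. *)
Lemma dvdn_fib_rank d q n : 0 < q -> d %| fib q ->
  all (fun r => (d %| fib r) == (r == 0)) (iota 0 q) ->
  (d %| fib n) = (q %| n).
Proof.
move=> q_gt0 dq /allP rank_q; rewrite (dvdn_fib_modn d q n) //.
by rewrite (eqP (rank_q _ _)) // mem_iota ltn_mod.
Qed.

Lemma dvdn3_fib n : (3 %| fib n) = (4 %| n).
Proof. exact: dvdn_fib_rank. Qed.

Lemma dvdn4_fib n : (4 %| fib n) = (6 %| n).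
Proof. exact: dvdn_fib_rank. Qed.

Lemma dvdn5_fib n : (5 %| fib n) = (5 %| n).
Proof. exact: dvdn_fib_rank. Qed.

Lemma dvdn9_fib n : (9 %| fib n) = (12 %| n).
Proof. exact: dvdn_fib_rank. Qed.

Lemma dvdn25_fib n : (25 %| fib n) = (25 %| n).
Proof. by apply: dvdn_fib_rank; [|vm_compute|vm_compute]. Qed.

Lemma fibDS m n :
  fib (m.+1 + n).+1 = (fib m.+1 + fib m) * fib n.+1 + fib m.+1 * fib n.
Proof. by rewrite -addnS fibD fibSS; ring. Qed.

Lemma fib_mul3 m : fib (3 * m.+1) =
  fib m.+1 * (3 * (fib m * fib m.+1 + fib m ^ 2) + 2 * fib m.+1 ^ 2).
Proof. by rewrite !mulSn mul0n !(fibD, fibDS) /=; ring. Qed.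

(** The grouping isolates [fib m ^ 4], the only term of the cofactor that survives modulo
    [fib m.+1]. *)
Lemma fib_mul5 m : fib (5 * m.+1) = 5 * fib m.+1 *
  (fib m.+1 * (2 * fib m ^ 3 + 4 * fib m.+1 * fib m ^ 2 +
    3 * fib m.+1 ^ 2 * fib m + fib m.+1 ^ 3) + fib m ^ 4).
Proof. by rewrite !mulSn mul0n !(fibD, fibDS) /=; ring. Qed.

Lemma dvdn_fib_mul3 j n : 4 %| n ->
  (3 ^ j.+1 %| fib (3 * n)) = (3 ^ j %| fib n).
Proof.
case: n => [|n]; first by rewrite muln0 !dvdn0.
rewrite -dvdn3_fib => /dvdnP[c fibE].
have co3 : coprime 3 (fib n).
  by have := coprime_fibS n; rewrite coprime_sym fibE coprimeMl => /andP[].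
(* As 3 divides [fib n.+1], the term [2 * fib n.+1 ^ 2] of [fib_mul3] also yields a factor 3. *)
have -> : fib (3 * n.+1) = 3 * (fib n.+1 *
    (3 * (c * fib n + 2 * c ^ 2) + fib n ^ 2)).
  by rewrite fib_mul3 fibE; ring.
rewrite expnS dvdn_pmul2l // Gauss_dvdl // coprimeXl //.
by rewrite mulnC /coprime gcdnMDl -/(coprime _ _) coprimeXr.
Qed.

Lemma dvdn_fib_mul5 j n : 5 %| n ->
  (5 ^ j.+1 %| fib (5 * n)) = (5 ^ j %| fib n).
Proof.
case: n => [|n]; first by rewrite muln0 !dvdn0.
rewrite -dvdn5_fib => dvd5.
have co5 : coprime 5 (fib n).
  by apply: coprime_dvdl dvd5 _; rewrite coprime_sym coprime_fibS.
rewrite fib_mul5 -mulnA expnS dvdn_pmul2l // Gauss_dvdl // coprimeXl //.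
case/dvdnP: dvd5 => c ->; rewrite -mulnA mulnCA mulnC.
by rewrite /coprime gcdnMDl -/(coprime _ _) coprimeXr.
Qed.

(** The lifting step goes from [4 * m] to [3 * (4 * m)], so it covers multiples of 12. For other [n]
    and positive [j] both sides fail, the left one because 9 does not divide [fib n]. *)
Lemma dvdn_exp3_fib j n : (3 ^ j.+1 %| fib n) = (4 * 3 ^ j %| n).
Proof.
elim: j n => [|j IHj] n; first exact: dvdn3_fib.
have [/dvdnP[m ->]|n12] := boolP (12 %| n).
  have -> : m * 12 = 3 * (4 * m) by lia.
  rewrite (dvdn_fib_mul3 _ (4 * m)) ?(dvdn_mulr m (dvdnn 4)) // IHj expnS.
  by rewrite mulnCA [in RHS]dvdn_pmul2l.
apply/idP/idP => dvd; case/negP: n12.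
  by rewrite -dvdn9_fib; apply: dvdn_trans dvd; rewrite (dvdn_exp2l 3 (m := 2)).
by apply: dvdn_trans dvd; rewrite expnS mulnA dvdn_mulr.
Qed.

(** Lifting to [5 * n] requires 5 to divide [n], so exponents 0 and 1 are both base cases. *)
Lemma dvdn_exp5_fib j n : (5 ^ j %| fib n) = (5 ^ j %| n).
Proof.
elim: j n => [|[|j] IHj] n; [by rewrite !dvd1n | exact: dvdn5_fib |].
have [/dvdnP[m ->]|n25] := boolP (25 %| n).
  have -> : m * 25 = 5 * (5 * m) by lia.
  rewrite (dvdn_fib_mul5 _ (5 * m)) ?(dvdn_mulr m (dvdnn 5)) // IHj.
  by rewrite [in RHS]expnS [in RHS]dvdn_pmul2l.
have d25 : 25 %| 5 ^ j.+2 by rewrite (dvdn_exp2l 5 (m := 2)).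
apply/idP/idP => /(dvdn_trans d25) dvd; case/negP: n25 => //.
by rewrite -dvdn25_fib.
Qed.

Lemma dvdn_fib_12_3_5 j a n :
  (12 * 3 ^ j * 5 ^ a %| fib n) = (12 * 3 ^ j.-1 * 5 ^ a %| n).
Proof.
have -> : 12 * 3 ^ j = 4 * 3 ^ j.+1 by rewrite expnS mulnA.
have co5 b i : coprime b 5 -> coprime (b * 3 ^ i) (5 ^ a).
  by move=> ?; rewrite coprimeMl !coprimeXr // coprimeXl.
rewrite !(Gauss_dvd _ (co5 _ _ _)) // Gauss_dvd ?coprimeXr //.
rewrite dvdn4_fib dvdn_exp3_fib dvdn_exp5_fib; congr andb.
(* For [j = 0] the divisors 6 and 4 combine to 12, which matches the truncated [j.-1]; for positive
   [j], 6 already divides [4 * 3 ^ j]. *)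
case: j => [|j] /=; first by rewrite !muln1; lia.
rewrite expnS mulnA; apply: andb_idl; apply: dvdn_trans.
by rewrite dvdn_mulr.
Qed.

Lemma order_of_appearance_eq n l : 0 < n -> 0 < l ->
  (forall m, (n %| fib m) = (l %| m)) -> order_of_appearance n = l.
Proof.
move=> n_gt0 l_gt0 rank_l; rewrite /order_of_appearance.
case: ex_minnP => m; rewrite n_gt0 rank_l /= => /andP[m_gt0 lm] min_m.
apply/eqP; rewrite eqn_leq (dvdn_leq m_gt0 lm) andbT min_m //.
by rewrite l_gt0 rank_l dvdnn.
Qed.

(** Truncated subtraction records that the orbit stays at [12 * 5 ^ a] from step [j] on. *)
Lemma iter_order_of_appearance i j a :
  iter i order_of_appearance (12 * 3 ^ j * 5 ^ a) = 12 * 3 ^ (j - i) * 5 ^ a.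
Proof.
elim: i => [|i IHi]; first by rewrite subn0.
rewrite iterS IHi subnS; apply: order_of_appearance_eq => [||m].
- by rewrite !muln_gt0 !expn_gt0.
- by rewrite !muln_gt0 !expn_gt0.
- exact: dvdn_fib_12_3_5.
Qed.

Lemma fixed_point_12_3_5 j a : fixed_point (12 * 3 ^ j * 5 ^ a) = (j == 0).
Proof.
rewrite /fixed_point !muln_gt0 !expn_gt0 /=.
have := iter_order_of_appearance 1 j a; rewrite /= => ->.
by rewrite eqn_pmul2r ?expn_gt0 // eqn_pmul2l // eqn_exp2l //; lia.
Qed.

Lemma has_fixed_point_order_12_3_5 k a :
  has_fixed_point_order (12 * 3 ^ k * 5 ^ a) k.
Proof.
rewrite /has_fixed_point_order fixed_point_12_3_5.
case: eqP => // /eqP k_neq0; split; first by rewrite lt0n.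
  by rewrite iter_order_of_appearance fixed_point_12_3_5 subnn.
(* The criterion [k - j == 0] is [k <= j] by definition. *)
by move=> j _; rewrite iter_order_of_appearance fixed_point_12_3_5.
Qed.

Local Open Scope classical_set_scope.

Theorem theorem1p3 (k : nat) (hk : 0 < k) :
  infinite_set [set n : nat | 0 < n /\ has_fixed_point_order n k].
Proof.
pose f a := 12 * 3 ^ k * 5 ^ a.
have f_inj : injective f.
  move=> a b /eqP; rewrite /f eqn_pmul2l ?muln_gt0 ?expn_gt0 //.
  by rewrite eqn_exp2l // => /eqP.
(* If the set were finite, so would be its preimage under [f], which contains every [a]. *)
move=> /(finite_preimage (in2W f_inj)); apply: sub_infinite_set infinite_nat.
move=> a _.
split; last exact: has_fixed_point_order_12_3_5.
by rewrite !muln_gt0 !expn_gt0.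
Qed.
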